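(* Let $\{(R_\lambda,M_\lambda)\}_{\lambda\in\Lambda}$ be a family of commutative local rings with identity indexed by an infinite set $\Lambda$, where $M_\lambda$ is the unique maximal ideal of $R_\lambda$, and let $R=\prod_{\lambda\in\Lambda}R_\lambda$. Then $|\mathrm{Max}(R)|=2^{2^{|\Lambda|}}$.
   Context: A commutative ring is called local if it has a unique maximal ideal (no Noetherian hypothesis). $\mathrm{Max}(R)$ denotes the set of all maximal ideals of $R$, and $|\cdot|$ denotes cardinality. *)

(* Defs.v *)
From HB Require Import structures.
From mathcomp Require Import all_boot all_algebra.
From mathcomp Require Import boolp classical_sets functions cardinality.

Set Implicit Arguments.
Unset Strict Implicit.
Unset Printing Implicit Defensive.

Import GRing.Theory.

Local Open Scope classical_set_scope.
Local Open Scope ring_scope.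

Section Ideals.
Variable R : comPzRingType.
Implicit Types I J M : set R.

(* [idealr] of ring_quotient is not used: it requires [nzRingType], whereas a
   product over an arbitrary index type is only a [comPzRingType], and it
   builds properness into the notion of ideal. See [proper_idealP]. *)
Definition ideal I : Prop :=
  [/\ I 0,
      forall x y, I x -> I y -> I (x + y)
    & forall a x, I x -> I (a * x)].

Definition maximal_ideal M : Prop :=
  [/\ ideal M,
      M <> setT
    & forall J, ideal J -> M `<=` J -> J = M \/ J = setT].

Definition Max : set (set R) := [set M | maximal_ideal M].

(* The zero ring has no maximal ideal, so local rings are nontrivial. *)
Definition local_ring M : Prop := Max = [set M].

End Ideals.

Arguments Max R : clear implicits.
Arguments local_ring R M : clear implicits.

Lemma proper_idealP (R : comNzRingType) (I : set R) :
  ideal I /\ I <> setT <-> idealr_closed [in I].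
Proof.
have memI x : (x \in [in I]) = `[< I x >] by [].
split=> [[[I0 ID IM] IT]|[]].
  split; first by rewrite memI; exact/asboolP.
    rewrite memI; apply/asboolP => I1; apply/IT/seteqP; split=> // x _.
    by rewrite -[x]mulr1; exact: IM.
  move=> a x y; rewrite !memI => /asboolP Ix /asboolP Iy.
  by apply/asboolP/ID => //; exact: IM.
rewrite !memI => /asboolP I0 /asboolP I1 IDM.
have {}IDM a x y : I x -> I y -> I (a * x + y).
  by have := IDM a x y; rewrite !memI => h /asboolP Ix /asboolP Iy; exact/asboolP/h.
split; last by move=> IT; apply: I1; rewrite IT.
split=> // [x y|a x] Ix; first by rewrite -[x]mul1r; exact: IDM.
by rewrite -[a * x]addr0; exact: IDM.
Qed.

Definition prod_ring (I : Type) (R : I -> comPzRingType) : Type :=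
  forall i, R i.

Section ProdRing.
Variables (I : Type) (R : I -> comPzRingType).
Implicit Types f g h : prod_ring R.

HB.instance Definition _ := Choice.copy (prod_ring R) (forall i, R i).

Definition prod_zero : prod_ring R := fun=> 0.
Definition prod_opp f : prod_ring R := fun i => - f i.
Definition prod_add f g : prod_ring R := fun i => f i + g i.
Definition prod_one : prod_ring R := fun=> 1.
Definition prod_mul f g : prod_ring R := fun i => f i * g i.

Let addA : associative prod_add.
Proof. by move=> f g h; apply: functional_extensionality_dep => i; exact: addrA. Qed.

Let addC : commutative prod_add.
Proof. by move=> f g; apply: functional_extensionality_dep => i; exact: addrC. Qed.

Let add0 : left_id prod_zero prod_add.
Proof. by move=> f; apply: functional_extensionality_dep => i; exact: add0r. Qed.

Let addN : left_inverse prod_zero prod_opp prod_add.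
Proof. by move=> f; apply: functional_extensionality_dep => i; exact: addNr. Qed.

Let mulA : associative prod_mul.
Proof. by move=> f g h; apply: functional_extensionality_dep => i; exact: mulrA. Qed.

Let mulC : commutative prod_mul.
Proof. by move=> f g; apply: functional_extensionality_dep => i; exact: mulrC. Qed.

Let mul1 : left_id prod_one prod_mul.
Proof. by move=> f; apply: functional_extensionality_dep => i; exact: mul1r. Qed.

Let mulD : left_distributive prod_mul prod_add.
Proof. by move=> f g h; apply: functional_extensionality_dep => i; exact: mulrDl. Qed.

HB.instance Definition _ :=
  GRing.isZmodule.Build (prod_ring R) addA addC add0 addN.
HB.instance Definition _ :=
  GRing.Zmodule_isComPzRing.Build (prod_ring R) mulA mulC mul1 mulD.

Lemma prod_ring0E i : (0 : prod_ring R) i = 0. Proof. by []. Qed.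
Lemma prod_ring1E i : (1 : prod_ring R) i = 1. Proof. by []. Qed.
Lemma prod_ringDE f g i : (f + g) i = f i + g i. Proof. by []. Qed.
Lemma prod_ringME f g i : (f * g) i = f i * g i. Proof. by []. Qed.

End ProdRing.

(* Main.v *)
Require Import Defs.
From mathcomp Require Import all_boot all_algebra.
From mathcomp Require Import boolp classical_sets functions cardinality.

(** The cardinality is pinned down by two injections and the
    Cantor-Bernstein theorem.

    Upper bound.  For a set A of indices let e_A be the idempotent equal to 1
    on A and to 0 elsewhere.  A maximal ideal N of the product is determined
    by the sets A with e_A in N ([max_idemE]): if f in N is a unit at every
    index of A, then e_A is a multiple of f, hence in N; conversely f lies in
    N as soon as e_A does, where A is the set of indices at which f is a unit,
    because f is, up to a multiple of e_A, in the Jacobson radical.  This is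
    the usual correspondence between maximal ideals and ultrafilters, read on
    the complements.  So there are at most as many maximal ideals as sets of
    sets of indices.

    Lower bound.  By the theorem of Fichtenholz, Kantorovich and Hausdorff, an
    infinite set L carries a family (J_A) of subsets, indexed by all subsets A
    of L, which is independent: any finite number of conditions, each of the
    form l in J_A or l not in J_A, with distinct indices A, is satisfied by
    some l ([infinite_independent]).  For a set P of subsets of L, the
    sequences that vanish wherever finitely many of the conditions
    (l in J_A iff A in P) hold form a proper ideal, contained in a maximal
    ideal m_P.  If P and Q differ at A, then m_P contains the idempotent of
    the set where l in J_A iff A in Q, and m_Q that of its complement; these
    add up to 1, so m_P and m_Q are distinct.

    The independent family is built on the finite sequences of finite
    sequences of points of L, and transported to L along an injection.  That
    such an injection exists for every infinite L ([infinite_seq_inj]) is a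
    form of Hessenberg's theorem, obtained by Zorn's lemma. *)

Set Implicit Arguments.
Unset Strict Implicit.
Unset Printing Implicit Defensive.

Import GRing.Theory.

Local Open Scope classical_set_scope.
Local Open Scope card_scope.

(** * Comparability of cardinals *)

(** A maximal partial matching between T and U exhausts one of the two types,
    for otherwise two unmatched points could be added to it. *)
Lemma injective_total (T U : Type) :
  (exists f : T -> U, injective f) \/ (exists f : U -> T, injective f).
Proof.
pose matching (G : set (T * U)) :=
  forall p q, G p -> G q -> p.1 = q.1 <-> p.2 = q.2.
have [F Fmatch Ftot|G [Gmatch Gmax]] := @Zorn_bigcup _ matching.
  move=> p q [X FX Xp] [Y FY Yq].
  by case: (Ftot X Y FX FY) => [XY|YX];
    [apply: (Fmatch Y FY) => //; exact: XY|apply: (Fmatch X FX) => //; exact: YX].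
have [Gdom|/existsNP[t /forallNP tNG]] := pselect (forall t, exists u, G (t, u)).
  left; have [f Gf] := choice Gdom.
  by exists f => x y fxy; have [_ /(_ fxy)] := Gmatch _ _ (Gf x) (Gf y).
have [Gran|/existsNP[u /forallNP uNG]] := pselect (forall u, exists t, G (t, u)).
  right; have [f Gf] := choice Gran.
  by exists f => x y fxy; have [/(_ fxy)] := Gmatch _ _ (Gf x) (Gf y).
exfalso; apply: (Gmax ((t, u) |` G)).
  by split=> [p|/(_ (t, u))]; [right|move=> /(_ (or_introl erefl)); exact: tNG].
move=> p q [->|Gp] [->|Gq] //=; last exact: Gmatch.
- by case: q Gq => a b /= Gq; split=> e; subst; [case: (tNG b)|case: (uNG a)].
- by case: p Gp => a b /= Gp; split=> e; subst; [case: (tNG b)|case: (uNG a)].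
Qed.

Lemma card_le_total (T U : Type) (A : set T) (B : set U) :
  A #<= B \/ B #<= A.
Proof.
have [[f f_inj]|[f f_inj]] := injective_total A B; [left|right].
  by apply/card_leP/injfunPex; exists f => // x y _ _; exact: f_inj.
by apply/card_leP/injfunPex; exists f => // x y _ _; exact: f_inj.
Qed.

(** * Finite sequences over an infinite type *)

Section SeqEmbedding.
Variable T : pointedType.
Implicit Types (G : set (seq T * T)) (s : seq T).

Definition supp G : set T := [set x | exists2 p, G p & x \in p.1].

(** These are the graphs of the injections from the nonempty sequences over a
    set A into A itself; A is not a separate parameter because it can be read
    off as [supp G].  Leaving out the empty sequence makes the empty graph a
    code (with A empty), so that the union of an empty chain is one as well. *)
Record seq_code G : Prop := SeqCode {
  seq_code_ran : forall s y, G (s, y) -> supp G y;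
  seq_code_dom : forall s, s != [::] -> [set` s] `<=` supp G ->
    exists y, G (s, y);
  seq_code_fun : forall p q, G p -> G q -> p.1 = q.1 <-> p.2 = q.2 }.

Lemma supp_sub G p : G p -> [set` p.1] `<=` supp G.
Proof. by move=> Gp x px; exists p. Qed.

Lemma supp_subset G H : G `<=` H -> supp G `<=` supp H.
Proof. by move=> GH x [p /GH Hp xp]; exists p. Qed.

(** Only [seq_code_dom] needs an argument: a sequence over the union of the
    supports has finitely many entries, hence is already a sequence over the
    support of a single member of the chain. *)
Lemma seq_code_bigcup (F : set (set (seq T * T))) :
  F `<=` seq_code -> total_on F subset -> seq_code (\bigcup_(X in F) X).
Proof.
move=> Fcode Ftot; set U := \bigcup_(X in F) X.
have FU X : F X -> X `<=` U by move=> FX p Xp; exists X.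
split=> [s y [X FX Xsy]|s s0 sU|p q [X FX Xp] [Y FY Yq]].
- exact: supp_subset (FU _ FX) _ (seq_code_ran (Fcode _ FX) Xsy).
- suff [X FX sX] : exists2 X, F X & [set` s] `<=` supp X.
    by have [y Xsy] := seq_code_dom (Fcode _ FX) s0 sX; exists y; exists X.
  elim: s s0 sU => // x s IHs _ sU.
  have [p [X FX Xp] xp] := sU x (mem_head x s).
  have [->|s0] := eqVneq s [::].
    by exists X => // z; rewrite /= inE => /eqP ->; exists p.
  have [|Y FY sY] := IHs s0.
    by move=> z zs; apply: sU; rewrite /= inE; apply/orP; right.
  have [XY|YX] := Ftot X Y FX FY.
    exists Y => // z /=; rewrite inE => /orP[/eqP->|/sY//].
    by apply: supp_subset XY _ _; exists p.
  exists X => // z /=; rewrite inE => /orP[/eqP->|/sY]; first by exists p.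
  exact: supp_subset.
- have [XY|YX] := Ftot X Y FX FY.
    by apply: (seq_code_fun (Fcode _ FY)) => //; exact: XY.
  by apply: (seq_code_fun (Fcode _ FX)) => //; exact: YX.
Qed.

(** A copy of the natural numbers supports a code, since finite sequences of
    natural numbers are countable; this excludes the empty code from being
    maximal. *)
Lemma seq_code_nat (g : nat -> T) : injective g ->
  exists2 G, seq_code G & supp G !=set0.
Proof.
move=> g_inj.
pose G := [set p | exists2 n : seq nat, n != [::] & p = (map g n, g (pickle n))].
have suppg n : supp G (g n).
  by exists ([:: g n], g (pickle [:: n])); [exists [:: n]|rewrite inE].
exists G; last by exists (g 0).
split=> [_ _ [n _ [_ ->]]|s s0 sG|_ _ [n _ ->] [m _ ->] /=].
- exact: suppg.
- suff [n sn] : exists n, s = map g n.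
    exists (g (pickle n)); exists n; last by rewrite sn.
    by apply: contra_neq s0; rewrite sn => ->.
  elim: s {s0} sG => [|x s IHs] sG; first by exists [::].
  have [|n ->] := IHs.
    by move=> z zs; apply: sG; rewrite /= inE; apply/orP; right.
  have [_ [k _ ->] /= /mapP[i _ ->]] := sG x (mem_head x s).
  by exists (i :: n).
- split=> [/(inj_map g_inj) -> //|/g_inj nm].
  by rewrite (pcan_inj pickleK nm).
Qed.

Lemma seq_code_fct G : seq_code G -> exists f : seq T -> T,
  forall s, s != [::] -> [set` s] `<=` supp G -> G (s, f s).
Proof.
move=> Gcode.
have /choice[f Gf] s : exists y, s != [::] -> [set` s] `<=` supp G -> G (s, y).
  have [[s0 sG]|nsG] := pselect (s != [::] /\ [set` s] `<=` supp G).
    by have [y Gsy] := seq_code_dom Gcode s0 sG; exists y.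
  by exists point => s0 sG; case: nsG.
by exists f.
Qed.

(** Absorption of a smaller set: if B injects into the support A of a code,
    then so does the union of A and B.  The code turns sequences over A into
    points of A, so that sequences of length 1 and 2 provide two disjoint
    copies of A inside A. *)
Lemma seq_code_absorb G (B : set T) (h : T -> T) :
  seq_code G -> set_fun B (supp G) h -> set_inj B h ->
  exists2 e : T -> T, set_fun (supp G `|` B) (supp G) e &
                      set_inj (supp G `|` B) e.
Proof.
move=> Gcode hBG h_inj; set A := supp G.
have [f Gf] := seq_code_fct Gcode.
pose c x := if `[< A x >] then [:: x] else [:: h x; h x].
have cA x : (A `|` B) x -> [set` c x] `<=` A.
  rewrite /c; case: asboolP => Ax.
    by move=> _ z /=; rewrite inE => /eqP ->.
  by case=> // Bx z /=; rewrite !inE orbb => /eqP ->; exact: hBG.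
have c0 x : c x != [::] by rewrite /c; case: ifP.
exists (f \o c) => [x ABx|x y].
  by apply: seq_code_ran (Gf _ _ (cA _ ABx)) => //.
move=> /set_mem ABx /set_mem ABy fxy.
have [_ /(_ fxy)/=] := seq_code_fun Gcode
  (Gf _ (c0 x) (cA _ ABx)) (Gf _ (c0 y) (cA _ ABy)).
rewrite /c; case: asboolP => Ax; case: asboolP => Ay; case=> // hxy.
by apply: h_inj => //; rewrite inE; [case: ABx|case: ABy].
Qed.

(** If the complement of the support A contains a copy h(A) of A, the code
    extends to the union B of A and h(A).  Indeed B is absorbed by A, by means
    of a map e, so a sequence over B becomes one over A, which has a code in
    A; the sequences over B that are not already sequences over A are sent to
    the copy of that code in h(A), where it cannot clash with the old codes. *)
Lemma seq_code_extend G (h : T -> T) :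
  seq_code G -> supp G !=set0 ->
  set_fun (supp G) (~` supp G) h -> set_inj (supp G) h ->
  exists2 H, seq_code H & G `<` H.
Proof.
move=> Gcode [a0 Aa0]; set A := supp G in Aa0 * => hA h_inj.
have /choice[k hK] x : exists y, (h @` A) x -> A y /\ h y = x.
  have [[y Ay <-]|] := pselect ((h @` A) x); last by exists point.
  by exists y.
have hAA x : (h @` A) x -> ~ A x by move=> [y Ay <-]; exact: hA.
have [||e eA e_inj] := @seq_code_absorb G (h @` A) k Gcode.
- by move=> x /hK[].
- move=> x y /set_mem hAx /set_mem hAy kxy.
  by have [_ <-] := hK x hAx; have [_ <-] := hK y hAy; rewrite kxy.
rewrite -/A in eA e_inj; set B := A `|` h @` A in eA e_inj.
have [f Gf] := seq_code_fct Gcode.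
have f_A s : s != [::] -> [set` s] `<=` A -> A (f s).
  by move=> s0 sA; exact: seq_code_ran (Gf _ s0 sA).
have f_inj s t : s != [::] -> t != [::] -> [set` s] `<=` A -> [set` t] `<=` A ->
    f s = f t -> s = t.
  by move=> s0 t0 sA tA; have [_] := seq_code_fun Gcode (Gf _ s0 sA) (Gf _ t0 tA).
(* the sequences that have yet to receive a code *)
pose N := [set s : seq T | [set` s] `<=` B /\ ~ [set` s] `<=` A].
have N0 s : N s -> s != [::] by case=> _; apply: contra_notN => /eqP ->.
have eN0 s : N s -> map e s != [::] by move=> /N0; case: s.
have eN s : N s -> [set` map e s] `<=` A.
  by move=> [sB _] _ /= /mapP[x xs ->]; apply/eA/sB.
pose H := G `|` [set p | N p.1 /\ p.2 = h (f (map e p.1))].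
have GH : G `<=` H by left.
have hN a : A a -> N [:: h a].
  move=> Aa; split=> [x|/(_ (h a))] /=; rewrite !inE.
    by move=> /eqP ->; right; exists a.
  by rewrite eqxx => /(_ isT); exact: hA.
have suppH : supp H = B.
  apply/seteqP; split=> [x [[s y] [Gsy|[[/= sB _] _]] xs]|x [Ax|[a Aa <-]]].
  - by left; exists (s, y).
  - exact: sB.
  - exact: supp_subset GH _ Ax.
  - exists ([:: h a], h (f (map e [:: h a]))); last by rewrite inE.
    by right; split=> //; exact: hN.
(* an old pair and a new pair differ in both components *)
have mix p q : G p -> N q.1 -> q.2 = h (f (map e q.1)) ->
    p.1 <> q.1 /\ p.2 <> q.2.
  move=> Gp Nq q2; split=> [p1|p2].
    by case: (Nq) => _; apply; rewrite -p1; exact: supp_sub.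
  apply: (hA _ (f_A _ (eN0 _ Nq) (eN _ Nq))); rewrite -q2 -p2.
  by case: p Gp {p2} => s y; exact: seq_code_ran.
exists H.
  split=> [s y|s s0|p q].
  - rewrite suppH => -[/(seq_code_ran Gcode)|[Ns /= ->]]; first by left.
    by right; exists (f (map e s)) => //; apply: f_A; [exact: eN0|exact: eN].
  - rewrite suppH => sB.
    have [sA|sA] := pselect ([set` s] `<=` A).
      by exists (f s); left; exact: Gf.
    by exists (h (f (map e s))); right.
  - case=> [Gp|[Np p2]] [Gq|[Nq q2]].
    + exact (seq_code_fun Gcode Gp Gq).
    + by have [p1 pq2] := mix _ _ Gp Nq q2; split=> [/p1|/pq2].
    + by have [p1 pq2] := mix _ _ Gq Np p2; split=> /esym => [/p1|/pq2].
    + rewrite p2 q2; split=> [-> //|/h_inj hpq].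
      have /f_inj : f (map e p.1) = f (map e q.1).
        by apply: hpq; rewrite inE; apply: f_A; by [exact: eN0|exact: eN].
      move=> /(_ (eN0 _ Np) (eN0 _ Nq) (eN _ Np) (eN _ Nq)).
      have [pB _] := Np; have [qB _] := Nq.
      elim: (p.1) (q.1) pB qB => [|x s IHs] [|y t] // sB tB [exy est].
      congr cons.
        by apply: e_inj => //; rewrite inE; [apply: sB|apply: tB]; exact: mem_head.
      by apply: IHs => // z zs; [apply: sB|apply: tB]; rewrite /= inE; apply/orP; right.
split=> // /(_ ([:: h a0], h (f (map e [:: h a0])))) HG.
case: (hA _ Aa0); exists ([:: h a0], h (f (map e [:: h a0]))); last by rewrite inE.
by apply: HG; right; split=> //; exact: hN.
Qed.

End SeqEmbedding.

(** The support A of a maximal code is nonempty and, by [seq_code_extend], its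
    complement contains no copy of A; by comparability the complement injects
    into A, so that the whole type is absorbed by A and sequences over it can
    be coded in A. *)
Lemma infinite_seq_inj (T : Type) :
  infinite_set [set: T] -> exists f : seq T -> T, injective f.
Proof.
elim/Ppointed: T => T; first by rewrite emptyE => /(_ (finite_set0 _)).
move=> /infiniteP/pcard_leP/injfunPex[g _ g_injT].
have g_inj : injective g by move=> m n; apply: g_injT; rewrite inE.
have [G [Gcode Gmax]] := Zorn_bigcup (@seq_code_bigcup T).
have [A0|/set0P suppN0] := eqVneq (supp G) set0.
  have [H Hcode [t Ht]] := seq_code_nat g_inj.
  case: (Gmax H) => //; split=> [[s y] /(seq_code_ran Gcode)|HG].
    by rewrite A0.
  by have := supp_subset HG Ht; rewrite A0.
have [|] := card_le_total (supp G) (~` supp G).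
  move=> /pcard_leP/injfunPex[h hA h_inj].
  have [H Hcode GH] := seq_code_extend Gcode suppN0 hA h_inj.
  by case: (Gmax H GH).
move=> /pcard_leP/injfunPex[h hA h_inj].
have [e eA e_inj] := seq_code_absorb Gcode hA h_inj.
rewrite setUCr in eA e_inj.
have [f Gf] := seq_code_fct Gcode.
have sA s : [set` map e s] `<=` supp G by move=> _ /mapP[x _ ->]; exact: eA.
(* the extra first entry makes every sequence nonempty *)
exists (fun s => f (map e (point :: s))) => s t fst.
have [_ /(_ fst)/=[/inj_map]] := seq_code_fun Gcode
  (Gf (map e (point :: s)) isT (sA _)) (Gf (map e (point :: t)) isT (sA _)).
by apply=> x y exy; apply: e_inj; rewrite ?inE.
Qed.

(** * Independent families of sets *)

Definition independent (I X : Type) (J : I -> set X) :=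
  forall (P : set I) (s : seq {classic I}),
    exists x, forall i, i \in s -> J i x <-> P i.

(** It suffices to collect, for each pair of distinct sets in [s], one point of
    their symmetric difference. *)
Lemma separating_seq (T : choiceType) (s : seq {classic (set T)}) :
  exists F : seq T, forall A B, A \in s -> B \in s ->
    (forall x, x \in F -> A x <-> B x) -> A = B.
Proof.
have /choice[w wP] (AB : set T * set T) :
    exists w : seq T, (forall x, x \in w -> AB.1 x <-> AB.2 x) -> AB.1 = AB.2.
  have [AB12|nAB] := pselect (AB.1 = AB.2); first by exists [::].
  have [x nx] : exists x, ~ (AB.1 x <-> AB.2 x).
    by apply/existsNP => AB12; apply: nAB; apply/predeqP.
  by exists [:: x] => /(_ x (mem_head _ _)).
exists (flatten [seq w (A, B) | A <- s, B <- s]) => A B As Bs AB.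
apply: (wP (A, B)) => x xw; apply: AB; apply/flattenP; exists (w (A, B)) => //.
exact: allpairs_f.
Qed.

(** A point F :: S consists of a finite sample F of T and of a finite list S of
    subsequences of F; it belongs to the set indexed by A when the trace of A
    on F is listed in S.  Given finitely many sets, F can be chosen so that
    their traces are distinct, and then S can prescribe membership at will. *)
Lemma independent_seq_seq (T : choiceType) :
  independent (fun (A : set T) (u : seq (seq T)) =>
    [seq x <- head [::] u | `[< A x >]] \in behead u).
Proof.
move=> P s; have [F Fsep] := separating_seq s.
pose tr (A : set T) := [seq x <- F | `[< A x >]].
exists (F :: [seq tr A | A : {classic (set T)} <- s & `[< P A >]]) => A As /=.
split=> [/mapP[B]|PA]; last first.
  apply: (map_f (tr : {classic (set T)} -> _)).
  by rewrite mem_filter As andbT; apply/asboolP.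
rewrite mem_filter => /andP[/asboolP PB Bs] trAB.
suff -> : A = B by [].
apply: Fsep => // x xF.
have : (x \in tr A) = (x \in tr B) by rewrite /tr trAB.
rewrite !mem_filter xF !andbT => AB.
by split=> /asboolP; [rewrite AB|rewrite -AB] => /asboolP.
Qed.

Lemma independent_image (I X Y : Type) (J : I -> set X) (f : X -> Y) :
  injective f -> independent J -> independent (fun i => f @` J i).
Proof.
move=> f_inj Jind P s; have [x Jx] := Jind P s; exists (f x) => i /Jx <-.
by split=> [[y Jy /f_inj <-]|Jix]; [|exists x].
Qed.

Lemma infinite_independent (T : Type) : infinite_set [set: T] ->
  exists J : set T -> set T, independent J.
Proof.
move=> /infinite_seq_inj[f f_inj].
pose g (u : seq (seq {classic T})) := f (map f u).
eexists; apply: (@independent_image _ _ _ _ g _ (@independent_seq_seq {classic T})).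
by move=> u v /f_inj/(inj_map f_inj).
Qed.

(** * Maximal ideals of a commutative ring *)

Local Open Scope ring_scope.

Section Ideals.
Variable R : comPzRingType.
Implicit Types I M : set R.

Lemma ideal_setT I : ideal I -> I 1 -> I = setT.
Proof.
move=> [_ _ IM] I1; apply/seteqP; split=> // x _.
by rewrite -[x]mulr1; exact: IM.
Qed.

Lemma max_ideal M : Max R M -> ideal M. Proof. by case. Qed.

Lemma max_proper M : Max R M -> ~ M 1.
Proof. by case=> idM MT _ M1; exact/MT/ideal_setT. Qed.

(** The elements y congruent to a multiple of x modulo M form an ideal strictly
    larger than M, so that 1 is one of them. *)
Lemma max_notin M x : Max R M -> ~ M x -> exists a, M (1 - a * x).
Proof.
move=> [[M0 MD MM] MT Mmax] nMx.
pose J := [set y | exists a, M (y - a * x)].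
have idJ : ideal J.
  split=> [|y z [a Ma] [b Mb]|c y [a Ma]].
  - by exists 0; rewrite mul0r subr0.
  - by exists (a + b); rewrite mulrDl opprD addrACA; exact: MD.
  - by exists (c * a); rewrite -mulrA -mulrBr; exact: MM.
have MJ : M `<=` J by move=> y My; exists 0; rewrite mul0r subr0.
have [JM|JT] := Mmax J idJ MJ.
  by case: nMx; rewrite -JM; exists 1; rewrite mul1r subrr.
by have : J 1 by rewrite JT.
Qed.

(** Zorn's lemma is applied to the sets J whose union with [I] is a proper ideal
    rather than to the proper ideals that contain [I]: in this form the union
    of an empty chain is still admissible. *)
Lemma exists_max_ideal I : ideal I -> ~ I 1 -> exists2 M, Max R M & I `<=` M.
Proof.
move=> [I0 ID IM] nI1.
pose P J := ideal (I `|` J) /\ ~ (I `|` J) 1.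
have [F FP Ftot|J [[idJ nJ1] Jmax]] := @Zorn_bigcup _ P.
  have FX X : F X -> I `|` X `<=` I `|` \bigcup_(X in F) X.
    by move=> FX x [Ix|Xx]; [left|right; exists X].
  split; last by case=> [//|[X /FP[_ nX1] X1]]; apply: nX1; right.
  split=> [|x y|a x]; first by left.
  - move=> [Ix|[X FX' Xx]] [Iy|[Y FY Yy]].
    + by left; exact: ID.
    + by apply: (FX _ FY); have [[_ YD _] _] := FP _ FY; apply: YD; [left|right].
    + by apply: (FX _ FX'); have [[_ XD _] _] := FP _ FX'; apply: XD; [right|left].
    + have [XY|YX] := Ftot _ _ FX' FY.
        apply: (FX _ FY); have [[_ YD _] _] := FP _ FY.
        by apply: YD; right => //; exact: XY.
      apply: (FX _ FX'); have [[_ XD _] _] := FP _ FX'.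
      by apply: XD; right => //; exact: YX.
  - move=> [Ix|[X FX' Xx]]; first by left; exact: IM.
    by apply: (FX _ FX'); have [[_ _ XM] _] := FP _ FX'; apply: XM; right.
exists (I `|` J); last by left.
split=> // [JT|K idK JK]; first by apply: nJ1; rewrite JT.
have [K1|nK1] := pselect (K 1); first by right; exact: ideal_setT.
left; apply/seteqP; split=> //; have IK : I `|` K = K.
  by apply/setUidPr => x Ix; apply: JK; left.
apply: contrapT => nKJ; apply: (Jmax K); last by rewrite /P IK.
split=> [x Jx|KJ]; first by apply: JK; right.
by apply: nKJ => x /KJ; right.
Qed.

(** Otherwise the ideal generated by x would be proper, hence contained in the
    only maximal ideal, M. *)
Lemma local_ring_inv M x : local_ring R M -> ~ M x -> exists y, y * x = 1.
Proof.
move=> locM nMx; pose J := [set z | exists y, z = y * x].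
have idJ : ideal J.
  split=> [|_ _ [a ->] [b ->]|c _ [a ->]].
  - by exists 0; rewrite mul0r.
  - by exists (a + b); rewrite mulrDl.
  - by exists (c * a); rewrite mulrA.
have [[y ->]|nJ1] := pselect (J 1); first by exists y.
have [N NMax JN] := exists_max_ideal idJ nJ1.
have NM : N = M by move: NMax; rewrite locM.
by case: nMx; rewrite -NM; apply: JN; exists 1; rewrite mul1r.
Qed.

Lemma local_ring_max M : local_ring R M -> Max R M.
Proof. by move=> ->. Qed.

End Ideals.

(** * Maximal ideals of a product of rings *)

Section Product.
Variables (L : Type) (R : L -> comPzRingType).
Implicit Types (A B : set L) (f : prod_ring R) (N : set (prod_ring R)).

Definition idem A : prod_ring R := fun l => if `[< A l >] then 1 else 0.

Lemma prod_ringP f g : (forall l, f l = g l) -> f = g.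
Proof. exact: functional_extensionality_dep. Qed.

Lemma idemDC A : idem A + idem (~` A) = 1.
Proof.
apply: prod_ringP => l; rewrite prod_ringDE /idem.
by case: asboolP => Al; case: asboolP => //= nAl; rewrite ?addr0 ?add0r.
Qed.

Lemma idem_sub N A B : ideal N -> A `<=` B -> N (idem B) -> N (idem A).
Proof.
move=> [_ _ NM] AB NB; suff -> : idem A = idem A * idem B by exact: NM.
apply: prod_ringP => l; rewrite prod_ringME /idem.
case: asboolP => Al; rewrite ?mul0r // mul1r.
by rewrite asboolT //; exact: AB.
Qed.

Section Local.
Variable (M : forall l, set (R l)).
Arguments M : clear implicits.
Hypothesis R_local : forall l, local_ring (R l) (M l).

(** In a local ring the elements outside the maximal ideal are the units. *)
Definition unit_locus f : set L := [set l | ~ M l (f l)].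

(** Dividing by f at each index of A shows that [idem A] is a multiple of f. *)
Lemma ideal_idem N A f : ideal N -> A `<=` unit_locus f -> N f -> N (idem A).
Proof.
move=> [_ _ NM] Af Nf.
have /(_ _)/cid-/all_sig[g gf] : forall l, exists y, A l -> y * f l = 1.
  move=> l; have [Al|nAl] := pselect (A l); last by exists 0.
  by have [y yf] := local_ring_inv (R_local l) (Af l Al); exists y.
suff -> : idem A = (idem A * g : prod_ring R) * f by exact: NM.
apply: prod_ringP => l; rewrite !prod_ringME /idem.
by case: asboolP => Al; rewrite ?mul0r // mul1r gf.
Qed.

(** For the converse, suppose that the idempotent of the unit locus U of f is
    in N but that f is not.  Then 1 - a * f is in N for some a.  Outside U, f
    takes its values in the maximal ideals, so 1 - a * f is a unit there and
    the idempotent of the complement of U is in N too; hence so is 1. *)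
Lemma max_idemE N f : Max (prod_ring R) N -> N f <-> N (idem (unit_locus f)).
Proof.
move=> NMax; have idN := max_ideal NMax; have [N0 ND NM] := idN.
split=> [|Ne]; first exact: ideal_idem.
apply: contrapT => /(max_notin NMax)[a Na].
apply: (max_proper NMax); rewrite -(idemDC (unit_locus f)); apply: ND => //.
apply: ideal_idem Na => // l /contrapT Mfl Ml.
have lMax := local_ring_max (R_local l); have [_ MD MM] := max_ideal lMax.
apply: (max_proper lMax); rewrite -(subrK (a l * f l) 1).
by apply: MD => //; exact: MM.
Qed.

Lemma max_prod_le : Max (prod_ring R) #<= [set: set (set L)].
Proof.
apply/pcard_leTP/injPex; exists (fun N => [set A | N (idem A)]).
move=> N N' /set_mem NMax /set_mem N'Max /predeqP NN'.
apply/predeqP => f; rewrite (max_idemE f NMax) (max_idemE f N'Max).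
exact: NN'.
Qed.

End Local.

(** For a set P of indices of the independent family J, [flaw P A] is the set of
    points l at which membership in J A disagrees with P.  The ideal I
    consists of the sequences supported in a finite union of such sets; it is proper because, J being
    independent, no finite union of them covers L.  If P and Q differ at A,
    then the complement of [flaw P A] is contained in [flaw Q A], so that a
    maximal ideal containing the idempotents of both would contain 1. *)
Lemma max_prod_ge : infinite_set [set: L] -> (forall l, 1 <> 0 :> R l) ->
  [set: set (set L)] #<= Max (prod_ring R).
Proof.
move=> Linf R_nontrivial; have [J Jind] := infinite_independent Linf.
pose flaw P A := [set l | ~ (J A l <-> P A)].
have /choice[m mP] P : exists N, Max (prod_ring R) N /\ forall A, N (idem (flaw P A)).
  pose I := [set f : prod_ring R | exists s : seq {classic (set L)},
    forall l, (forall A, A \in s -> J A l <-> P A) -> f l = 0].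
  have idI : ideal I.
    split=> [|f g [s fs] [t gt]|a f [s fs]].
    - by exists [::].
    - exists (s ++ t) => l stl; rewrite prod_ringDE fs ?gt ?addr0 // => A Ast;
        apply: stl; by rewrite mem_cat Ast ?orbT.
    - by exists s => l sl; rewrite prod_ringME fs ?mulr0.
  have nI1 : ~ I 1.
    by move=> [s s1]; have [l sl] := Jind P s; exact/(R_nontrivial l)/s1.
  have [N NMax IN] := exists_max_ideal idI nI1; exists N; split=> // A; apply: IN.
  exists [:: A : {classic (set L)}] => l /(_ A (mem_head _ _)) JA.
  by rewrite /idem asboolF.
apply/pcard_leP/injfunPex; exists m => [P _|P Q _ _ mPQ]; first by have [] := mP P.
have [mMax mflaw] := mP P; have [_ mflaw'] := mP Q; rewrite -mPQ in mflaw'.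
apply: contrapT => nPQ; apply: (max_proper mMax).
have [A nA] : exists A, ~ (P A <-> Q A).
  by apply/existsNP => PQ; apply: nPQ; apply/predeqP.
rewrite -(idemDC (flaw P A)); have [_ mD _] := max_ideal mMax; apply: mD => //.
apply: idem_sub (mflaw' A); first exact: max_ideal.
by move=> l /contrapT JP JQ; apply: nA; rewrite -JP.
Qed.

End Product.

Theorem theorem3p11 (L : Type) (R : L -> comPzRingType)
    (M : forall l : L, set (R l)) (L_infinite : infinite_set [set: L])
    (R_local : forall l : L, local_ring (R l) (M l)) :
  Max (prod_ring R) #= [set: set (set L)].
Proof.
rewrite card_eq_le (max_prod_le R_local) max_prod_ge // => l e.
have lMax := local_ring_max (R_local l).
by apply: (max_proper lMax); rewrite e; have [] := max_ideal lMax.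
Qed.
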